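(* Let $n,\lambda\ge2$ be even integers, $m=1+\frac{\lambda}{2}$, $\sigma>0$, $b_0>0$ and $0<\delta<\frac{b_0}{2(m+1)}$. Let $\rho$, $c_0$, $c_1$, $k$ and the function $MN:[c_0,\infty)\to(0,\infty)$ be as defined in the context. If $\lambda-n-1\ge0$ and $k<0$, then the optimal choice of $c\in[c_0,\infty)$ is $c^*\in[c_0,c_1]$ which minimizes $MN$ on $[c_0,c_1]$; that is, a minimizer $c^*$ of $MN$ on $[c_0,c_1]$ exists, and any such $c^*$ minimizes $MN$ over $[c_0,\infty)$.
   Context: The constant $\rho$ is: $\rho=1+\frac{s}{2m+3}$ with $s=\lceil\frac{n-\lambda-3}{2}\rceil$ if $n-\lambda>3$; $\rho=1$ if $n-\lambda\le3$. $c_0:=24\rho(m+1)\delta$, $c_1:=12\rho b_0$, $k:=\frac{\sigma}{2}+\frac{\ln\frac23}{24\rho\delta}$. The MN function (for band-limited functions in $B_\sigma$, with $b_0$ fixed) is $$MN(c)=\begin{cases}\sqrt{8\rho}\,c^{\frac{\lambda-n-1}{4}}e^{c\left[\frac{\sigma}{2}+\frac{\ln\frac23}{24\rho\delta}\right]} & c_0\le c\le c_1,\\[1ex] \sqrt{\frac{2}{3b_0}}\,c^{\frac{1+\lambda-n}{4}}e^{\frac{c\sigma}{2}}\left(\frac23\right)^{\frac{b_0}{2\delta}} & c_1\le c<\infty.\end{cases}$$ The two formulas agree at $c=c_1$. A value of $c\in[c_0,\infty)$ is called optimal if it minimizes $MN$ over $[c_0,\infty)$. *)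

(* Defs.v *)
From HB Require Import structures.
From mathcomp Require Import all_boot all_order all_algebra.
From mathcomp Require Import all_classical all_reals all_analysis.

Set Implicit Arguments.
Unset Strict Implicit.
Unset Printing Implicit Defensive.

Import Order.TTheory GRing.Theory Num.Theory.

Local Open Scope classical_set_scope.
Local Open Scope ring_scope.

(* The halving is exact for even lam. *)
Definition mval (lam : nat) : nat := (1 + lam./2)%N.

Definition sval (R : realType) (n lam : nat) : int :=
  Num.ceil ((n%:R - lam%:R - 3) / 2 : R).

Definition rho (R : realType) (n lam : nat) : R :=
  if 3 < n%:Z - lam%:Z then 1 + (sval R n lam)%:~R / (2 * mval lam + 3)%N%:R
  else 1.

Definition c0 (R : realType) (n lam : nat) (delta : R) : R :=
  24 * rho R n lam * (mval lam + 1)%N%:R * delta.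

Definition c1 (R : realType) (n lam : nat) (b0 : R) : R :=
  12 * rho R n lam * b0.

Definition kval (R : realType) (n lam : nat) (sigma delta : R) : R :=
  sigma / 2 + ln (2 / 3) / (24 * rho R n lam * delta).

(* Only the values on [c0, +oo[ are meaningful; at c = c1 the two formulas
   agree, so assigning c1 to the first branch is immaterial. *)
Definition MN (R : realType) (n lam : nat) (sigma b0 delta c : R) : R :=
  if c <= c1 n lam b0 then
    Num.sqrt (8 * rho R n lam) * c `^ ((lam%:R - n%:R - 1) / 4)
    * expR (c * kval n lam sigma delta)
  else
    Num.sqrt (2 / (3 * b0)) * c `^ ((1 + lam%:R - n%:R) / 4)
    * expR (c * sigma / 2) * (2 / 3) `^ (b0 / (2 * delta)).

Definition minimizes_on (R : realType) (f : R -> R) (A : set R) (c : R) : Prop :=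
  A c /\ forall x, A x -> f c <= f x.

(* Main.v *)
Require Import Defs.
From HB Require Import structures.
From mathcomp Require Import all_boot all_order all_algebra.
From mathcomp Require Import all_classical all_reals all_analysis.
From mathcomp Require Import ring lra.

Import Order.TTheory GRing.Theory Num.Theory.
Import numFieldNormedType.Exports.

Local Open Scope classical_set_scope.
Local Open Scope ring_scope.

(** On [c1, +oo[ the function MN is a product of a nonnegative power of c and an
    increasing exponential, hence nondecreasing: every value there dominates
    MN(c1), and c1 already belongs to [c0, c1], on which MN is continuous. *)

Lemma powR_continuous_at (R : realType) (a x : R) :
  0 < x -> {for x, continuous (fun y : R => y `^ a)}.
Proof.
move=> x0; apply/differentiable_continuous/derivable1_diffP.
by apply: derivable_powR; rewrite in_itv/= x0.
Qed.

Lemma rho_eq1 (R : realType) (n lam : nat) :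
  n%:Z - lam%:Z <= 3 -> rho R n lam = 1.
Proof. by rewrite /rho leNgt; case: ifP. Qed.

Lemma c0_gt0 (R : realType) (n lam : nat) (delta : R) :
  0 < rho R n lam -> 0 < delta -> 0 < c0 n lam delta.
Proof. by move=> r0 d0; rewrite /c0 !mulr_gt0// ltr0n addn1. Qed.

(** Both ends carry the factor [12 * rho]; what remains to compare is [2(m+1) delta] with [b0],
    which is the bound on [delta] with its denominator cleared. *)
Lemma c0_le_c1 (R : realType) (n lam : nat) (b0 delta : R) :
  0 < rho R n lam -> delta < b0 / (2 * (mval lam + 1)%N%:R) ->
  c0 n lam delta <= c1 n lam b0.
Proof.
move=> r0; have m0 : 0 < (mval lam + 1)%N%:R :> R by rewrite ltr0n addn1.
rewrite /c0 /c1 ltr_pdivlMr ?mulr_gt0// => dlt.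
have -> : 24 * rho R n lam * (mval lam + 1)%N%:R * delta
  = 12 * rho R n lam * (delta * (2 * (mval lam + 1)%N%:R)) by ring.
by rewrite ler_wpM2l ?(ltW dlt)// mulr_ge0// ltW.
Qed.

Lemma MN_continuous (R : realType) (n lam : nat) (sigma b0 delta : R) :
  0 < c0 n lam delta ->
  {within `[c0 n lam delta, c1 n lam b0], continuous (MN n lam sigma b0 delta)}.
Proof.
move=> c00.
(* Continuity within the interval sees only values there, where the test [c <= c1] succeeds, so the
   first formula replaces [MN]. It is continuous at each point since [c0 > 0] keeps the power away
   from zero. *)
apply: (@subspace_eq_continuous _ _ _ (fun c : R => Num.sqrt (8 * rho R n lam)
    * c `^ ((lam%:R - n%:R - 1) / 4) * expR (c * kval n lam sigma delta))).
  by move=> c; rewrite inE/= in_itv/= /from_subspace /MN => /andP[_ ->].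
apply: continuous_in_subspaceT => c; rewrite inE/= in_itv/= => /andP[c0c _].
apply: cvgM.
  by apply: cvgM; [exact: cvg_cst | exact/powR_continuous_at/(lt_le_trans c00)].
apply: (@continuous_comp _ _ _ (fun c : R => c * _) expR).
  by apply: cvgM; [exact: cvg_id | exact: cvg_cst].
exact: continuous_expR.
Qed.

(** The second branch of [MN] freed from its case test, so that it can be evaluated at [c1], where
    [MN] uses the first branch. *)
Definition MN_tail {R : realType} (n lam : nat) (sigma b0 delta c : R) : R :=
  Num.sqrt (2 / (3 * b0)) * c `^ ((1 + lam%:R - n%:R) / 4)
  * expR (c * sigma / 2) * (2 / 3) `^ (b0 / (2 * delta)).

Lemma MN_c1 (R : realType) (n lam : nat) (sigma b0 delta : R) :
  0 < rho R n lam -> 0 < b0 -> 0 < delta ->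
  MN n lam sigma b0 delta (c1 n lam b0)
  = MN_tail n lam sigma b0 delta (c1 n lam b0).
Proof.
move=> r0 b00 d0; rewrite /MN lexx /MN_tail.
have c10 : 0 < c1 n lam b0 by rewrite /c1 !mulr_gt0.
(* As [c1 = 12 rho b0], the two constants under the square roots differ by the factor [c1]. *)
have -> : 8 * rho R n lam = 2 / (3 * b0) * c1 n lam b0.
  by rewrite /c1; field; rewrite gt_eqF.
rewrite sqrtrM; last by rewrite divr_ge0// mulr_ge0// ltW.
(* The exponents of the two branches differ by 1/2, which absorbs the factor [sqrt c1] just
   released. *)
have -> : (1 + lam%:R - n%:R) / 4 = 2^-1 + (lam%:R - n%:R - 1) / 4 :> R by field.
rewrite powRD ?(gt_eqF c10) ?implybT// powR12_sqrt ?ltW//.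
(* Since [c1 / (24 rho delta) = b0 / (2 delta)], the logarithmic part of [k] exponentiates to the
   power of 2/3 in the second branch. *)
have -> : c1 n lam b0 * kval n lam sigma delta
  = c1 n lam b0 * sigma / 2 + b0 / (2 * delta) * ln (2 / 3).
  by rewrite /c1 /kval; field; rewrite !gt_eqF.
by rewrite expRD {3}/powR gt_eqF ?divr_gt0// !mulrA.
Qed.

Lemma MN_tail_nondecreasing (R : realType) (n lam : nat)
    (sigma b0 delta x y : R) :
  0 <= sigma -> (n <= lam + 1)%N -> 0 <= x -> x <= y ->
  MN_tail n lam sigma b0 delta x <= MN_tail n lam sigma b0 delta y.
Proof.
move=> s0 nlam x0 xy; rewrite /MN_tail ler_wpM2r ?powR_ge0//.
apply: ler_pM; rewrite ?mulr_ge0 ?powR_ge0 ?sqrtr_ge0 ?expR_ge0//.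
  rewrite ler_wpM2l ?sqrtr_ge0//; apply: ge0_ler_powR => //.
  (* The exponent [(1 + lam - n) / 4] is nonnegative exactly when [n <= lam + 1]. *)
  - by rewrite divr_ge0// subr_ge0 nat1r ler_nat -addn1.
  - by rewrite nnegrE (le_trans x0).
by rewrite ler_expR ler_wpM2r// ler_wpM2r.
Qed.

Lemma MN_ge_c1 (R : realType) (n lam : nat) (sigma b0 delta c : R) :
  0 < rho R n lam -> 0 <= sigma -> 0 < b0 -> 0 < delta -> (n <= lam + 1)%N ->
  c1 n lam b0 < c ->
  MN n lam sigma b0 delta (c1 n lam b0) <= MN n lam sigma b0 delta c.
Proof.
move=> r0 s0 b00 d0 nlam c1c; rewrite MN_c1//.
rewrite /MN (leNgt c) c1c/= -/(MN_tail n lam sigma b0 delta c).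
by apply: MN_tail_nondecreasing => //; rewrite ?ltW// /c1 !mulr_gt0.
Qed.

Theorem mainTheorem4 (R : realType) (n lam : nat) (sigma b0 delta : R)
    (hn : (2 <= n)%N) (hn_even : ~~ odd n)
    (hlam : (2 <= lam)%N) (hlam_even : ~~ odd lam)
    (hsigma : 0 < sigma) (hb0 : 0 < b0)
    (hdelta : 0 < delta) (hdelta_lt : delta < b0 / (2 * (mval lam + 1)%N%:R))
    (hexp : 0 <= lam%:Z - n%:Z - 1)
    (hk : kval n lam sigma delta < 0) :
  (exists c : R,
     minimizes_on (MN n lam sigma b0 delta) `[c0 n lam delta, c1 n lam b0] c) /\
  (forall c : R,
     minimizes_on (MN n lam sigma b0 delta) `[c0 n lam delta, c1 n lam b0] c ->
     minimizes_on (MN n lam sigma b0 delta) `[c0 n lam delta, +oo[ c).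
Proof.
(* [hexp] gives [n - lam <= -1], so [rho] falls in its constant case. *)
have r0 : 0 < rho R n lam by rewrite rho_eq1//; lra.
have nlam : (n <= lam + 1)%N by rewrite -lez_nat PoszD; lra.
have c01 : c0 n lam delta <= c1 n lam b0 by exact: c0_le_c1.
split=> [|c [/= + cmin]].
  have [c cI cmin] :=
    EVT_min c01 (@MN_continuous R n lam sigma b0 delta (c0_gt0 _ _ _ _ r0 hdelta)).
  by exists c.
rewrite in_itv/= => /andP[c0c _]; split; first by rewrite /= in_itv/= c0c.
move=> x; rewrite /= in_itv/= andbT => c0x.
have [xc1|c1x] := leP x (c1 n lam b0); first by apply: cmin; rewrite /= in_itv/= c0x.
(* Beyond [c1] the comparison passes through the endpoint: [MN c <= MN c1 <= MN x]. *)
apply: le_trans (MN_ge_c1 _ _ _ _ _ _ _ r0 (ltW hsigma) hb0 hdelta nlam c1x).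
by apply: cmin; rewrite /= in_itv/= c01/=.
Qed.
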